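(* There is an algorithm which, given words $u_1,\dots,u_n,v_1,\dots,v_n\in\Sigma^*$ of length at most $\ell$ and $k\in\mathbb{N}$, decides whether there is an $\mathbf{LTL}$ formula of size at most $k$ separating $u_1,\dots,u_n$ from $v_1,\dots,v_n$. The algorithm runs in time and space $O(e(k)\cdot n\cdot \ell)$ for some function $e(k)$ exponential in $k$, i.e. $e(k)=2^{O(k)}$.
   Context: Alphabet $\Sigma=\{a,b\}$. Words are nonempty and indexed from position 1; $w(i)$ is the letter at position $i$ of $w=w(1)\cdots w(\ell)$. $\mathbf{LTL}$ formulas are built from atomic formulas $c\in\Sigma$, the binary connectives $\wedge,\vee$ and the unary operators $\mathbf{X},\mathbf{F},\mathbf{G}$. Semantics over a finite word $w$ of length $\ell$ at position $i\in[1,\ell]$: $w,i\models c$ iff $w(i)=c$; the connectives $\wedge,\vee$ are interpreted as usual; $w,i\models\mathbf{X}\phi$ iff $i<\ell$ and $w,i+1\models\phi$; $w,i\models\mathbf{F}\phi$ iff $w,i'\models\phi$ for some $i'\in[i,\ell]$; $w,i\models\mathbf{G}\phi$ iff $w,i'\models\phi$ for all $i'\in[i,\ell]$. Write $w\models\phi$ iff $w,1\models\phi$. The size of a formula is the number of nodes of its syntax tree. A formula $\phi$ separates $u_1,\dots,u_n$ from $v_1,\dots,v_m$ if $u_j\models\phi$ for all $j$ and $v_j\not\models\phi$ for all $j$. *)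

(* Defs.v *)
From mathcomp Require Import all_boot.
Set Implicit Arguments. Unset Strict Implicit. Unset Printing Implicit Defensive.

Inductive letter := La | Lb.

Inductive ltl :=
| Atom of letter
| And of ltl & ltl
| Or of ltl & ltl
| Next of ltl
| Fin of ltl
| Glob of ltl.

Fixpoint fsize (f : ltl) : nat :=
  match f with
  | Atom _ => 1
  | And p q | Or p q => (fsize p + fsize q).+1
  | Next p | Fin p | Glob p => (fsize p).+1
  end.

(** w(i) is the letter at position i, positions indexed from 1. *)
Definition letter_at (w : seq letter) (i : nat) : letter := nth La w i.-1.

(** w, i |= f, for i in [1, size w] *)
Fixpoint sat (w : seq letter) (f : ltl) (i : nat) : Prop :=
  match f with
  | Atom c => letter_at w i = c
  | And p q => sat w p i /\ sat w q i
  | Or p q => sat w p i \/ sat w q i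
  | Next p => i < size w /\ sat w p i.+1
  | Fin p => exists i', i <= i' <= size w /\ sat w p i'
  | Glob p => forall i', i <= i' <= size w -> sat w p i'
  end.

Definition models (w : seq letter) (f : ltl) : Prop := sat w f 1.

Definition separates (f : ltl) (us vs : seq (seq letter)) : Prop :=
  (forall j, j < size us -> models (nth [::] us j) f) /\
  (forall j, j < size vs -> ~ models (nth [::] vs j) f).

(** * A model of computation: deterministic multi-tape Turing machines
    with a fixed (machine-dependent) number of one-way-infinite tapes,
    finitely many states and a finite tape alphabet.
    Tape symbols are 'I_(tm_nsyms.+4.+2); the symbols 0..5 are reserved:
      0 = blank, 1 = letter a, 2 = letter b,
      3 = end-of-positive-word marker, 4 = end-of-negative-word marker,
      5 = unary digit (for k).
    Tape 0 is the input tape; all tapes are read/write. *)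

Inductive move := MLeft | MStay | MRight.

Record TM : Type := {
  tm_nstates : nat;
  tm_nsyms : nat;
  tm_ntapes : nat;
  tm_delta : 'I_(tm_nstates.+1) -> (tm_ntapes.+1).-tuple 'I_(tm_nsyms.+4.+2) ->
             option ('I_(tm_nstates.+1) * (tm_ntapes.+1).-tuple ('I_(tm_nsyms.+4.+2) * move));
  tm_accept : 'I_(tm_nstates.+1) -> bool
}.

Record cfg (M : TM) := Cfg {
  cst : 'I_((tm_nstates M).+1);
  ctape : 'I_((tm_ntapes M).+1) -> nat -> 'I_((tm_nsyms M).+4.+2);
  chead : 'I_((tm_ntapes M).+1) -> nat
}.

Definition movehead (m : move) (h : nat) : nat :=
  match m with MLeft => h.-1 | MStay => h | MRight => h.+1 end.

Definition read (M : TM) (c : cfg M) : (tm_ntapes M).+1.-tuple 'I_((tm_nsyms M).+4.+2) :=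
  [tuple ctape c i (chead c i) | i < (tm_ntapes M).+1].

Definition halted (M : TM) (c : cfg M) : bool :=
  if tm_delta (cst c) (read c) is None then true else false.

Definition step (M : TM) (c : cfg M) : cfg M :=
  match tm_delta (cst c) (read c) with
  | None => c
  | Some (q, acts) =>
      @Cfg M q
        (fun i p => if p == chead c i then (tnth acts i).1 else ctape c i p)
        (fun i => movehead (tnth acts i).2 (chead c i))
  end.

(** initial configuration on input x (a list of symbol codes < 6):
    x written on tape 0 from cell 0, everything else blank, heads at 0 *)
Definition init (M : TM) (x : seq nat) : cfg M :=
  @Cfg M ord0 (fun i p => if i == ord0 then inord (nth 0 x p) else inord 0)
       (fun _ => 0).

Definition run (M : TM) (x : seq nat) (t : nat) : cfg M := iter t (@step M) (init M x).

(** M halts on x within T steps, accepting iff P, and during the whole run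
    no head leaves the first S cells of its tape (space <= #tapes * S) *)
Definition decides_within (M : TM) (x : seq nat) (P : Prop) (T S : nat) : Prop :=
  exists t, t <= T /\ halted (run M x t) /\
    (@tm_accept M (cst (run M x t)) = true <-> P) /\
    (forall t', t' <= t -> forall i, chead (run M x t') i < S).

Definition letter_code (c : letter) : nat := if c is La then 1 else 2.

Definition encode (us vs : seq (seq letter)) (k : nat) : seq nat :=
  flatten [seq map letter_code u ++ [:: 3] | u <- us] ++
  flatten [seq map letter_code v ++ [:: 4] | v <- vs] ++ nseq k 5.

Definition separable_within (k : nat) (us vs : seq (seq letter)) : Prop :=
  exists f, fsize f <= k /\ separates f us vs.

(* Main.v *)
Require Import Defs.
From mathcomp Require Import all_boot zify.

(* A formula of size at most [k] is a postfix word of [k] operators, one of which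
   does nothing, so it suffices to test the [8 ^ k] words of that length.  Reading
   an input word from right to left, the values of all subformulas at a position
   follow from their values at the next one, and one bit for each temporal operator
   is enough memory: a pass over the postfix word with a stack of truth values
   takes time O(k) per input letter.  The words of operators are enumerated as the
   numbers below [8 ^ k] in base 8.  A head moves at most one cell per step, so the
   space bound follows from the time bound. *)

Set Implicit Arguments. Unset Strict Implicit. Unset Printing Implicit Defensive.

(** * The machine *)

Inductive op := Onop | Oa | Ob | Oand | Oor | Onext | Ofin | Oglob.

Definition op_code (o : op) : nat :=
  match o with
  | Onop => 0 | Oa => 1 | Ob => 2 | Oand => 3
  | Oor => 4 | Onext => 5 | Ofin => 6 | Oglob => 7
  end.

Definition ops : seq op := [:: Onop; Oa; Ob; Oand; Oor; Onext; Ofin; Oglob].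

Inductive sym := Bl | SA | SB | M3 | M4 | D5 | Cell of op & bool.

Definition sym_code (x : sym) : nat :=
  match x with
  | Bl => 0 | SA => 1 | SB => 2 | M3 => 3 | M4 => 4 | D5 => 5
  | Cell o b => 6 + (op_code o).*2 + b
  end.

(** Listed in the order of [sym_code], because [ord_sym] decodes by position. *)
Definition syms : seq sym :=
  [:: Bl; SA; SB; M3; M4; D5] ++ [seq Cell o b | o <- ops, b <- [:: false; true]].

Definition is_blank (x : sym) : bool := if x is Bl then true else false.

Definition letter_sym (c : letter) : sym := if c is La then SA else SB.

Definition mark_sym (p : bool) : sym := if p then M3 else M4.

Definition bool_sym (b : bool) : sym := if b then SA else SB.

Inductive phase :=
| PInit | PCopy | PRewind | PMain | PEval | PUnary | PBin | PBin2 of bool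
| PEnd | PNext | PInc | PAcc | PRej.

(* The registers are, in this order: the polarity of the current word, whether
   the value of the formula at the last position read agrees with it, and
   whether no position of the current word has been read yet. *)
Definition state : Type := (phase * bool * bool * bool)%type.

Definition phase_code (q : phase) : nat :=
  match q with
  | PInit => 0 | PCopy => 1 | PRewind => 2 | PMain => 3 | PEval => 4
  | PUnary => 5 | PBin => 6 | PBin2 v => 7 + v | PEnd => 9 | PNext => 10
  | PInc => 11 | PAcc => 12 | PRej => 13
  end.

Definition phases : seq phase :=
  [:: PInit; PCopy; PRewind; PMain; PEval; PUnary; PBin; PBin2 false;
      PBin2 true; PEnd; PNext; PInc; PAcc; PRej].

Definition state_code (q : state) : nat :=
  let: (ph, pol, ok, fr) := q in phase_code ph * 8 + pol * 4 + ok * 2 + fr.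

Definition state0 : state := (PInit, false, false, false).

Definition states : seq state :=
  [seq (x, fr) | x <- [seq (y, ok) | y <- [seq (ph, pol) | ph <- phases,
     pol <- [:: false; true]], ok <- [:: false; true]], fr <- [:: false; true]].

Definition action : Type := (sym * move)%type.

Definition stay (x : sym) : action := (x, MStay).
Definition left (x : sym) : action := (x, MLeft).
Definition right (x : sym) : action := (x, MRight).

Definition is_binary (o : op) : bool :=
  match o with Oand | Oor => true | _ => false end.

Definition binary_val (o : op) (u v : bool) : bool :=
  if o is Oand then u && v else u || v.

(* The bit of a cell is the value at the next position of the argument of X,
   respectively of the whole subformula for F and G. *)
Definition unary_bit (o : op) (fr b : bool) : bool :=
  if fr then (if o is Oglob then true else false) else b.

Definition unary_val (o : op) (b v : bool) : bool :=
  match o with Onext => b | Ofin => v || b | _ => v && b end.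

Definition unary_new (o : op) (b v : bool) : bool :=
  match o with Onext => v | Ofin => v || b | _ => v && b end.

Definition op_succ (o : op) : option op :=
  match o with
  | Onop => Some Oa | Oa => Some Ob | Ob => Some Oand | Oand => Some Oor
  | Oor => Some Onext | Onext => Some Ofin | Ofin => Some Oglob | Oglob => None
  end.

Definition sym_bool (x : sym) : option bool :=
  match x with SA => Some true | SB => Some false | _ => None end.

(* Tapes: 0 input, 1 copy of the words, 2 candidate formula in postfix notation,
   3 stack of truth values with the head just right of its top.  Cell 0 of tapes
   1 and 2 stays blank to mark the left end. *)
Definition delta (q : state) (x0 x1 x2 x3 : sym) :
    option (state * action * action * action * action) :=
  let: (ph, pol, ok, fr) := q in
  match ph with
  | PInit => Some ((PCopy, pol, ok, fr), stay x0, right Bl, right Bl, stay x3)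
  | PCopy =>
    match x0 with
    | Bl => Some ((PRewind, pol, true, fr), stay x0, left Bl, left Bl, stay x3)
    | D5 => Some (q, right x0, stay x1, right (Cell Onop false), stay x3)
    | _ => Some (q, right x0, right x0, stay x2, stay x3)
    end
  | PRewind =>
    if is_blank x2 then
      Some ((PMain, pol, ok, fr), stay x0, stay x1, right Bl, left Bl)
    else Some (q, stay x0, stay x1, left x2, left Bl)
  | PMain =>
    match x1 with
    | SA | SB => Some ((PEval, pol, ok, fr), stay x0, stay x1, stay x2, stay x3)
    | Bl => Some (if ok then (PAcc, pol, ok, fr) else (PNext, pol, ok, fr),
                  stay x0, right x1, stay x2, stay x3)
    | _ => if ok then
             Some ((PMain, if x1 is M3 then true else false, false, true),
                   stay x0, left x1, stay x2, stay x3)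
           else Some ((PNext, pol, ok, fr), stay x0, stay x1, stay x2, stay x3)
    end
  | PEval =>
    match x2 with
    | Cell Onop b => Some (q, stay x0, stay x1, right x2, stay x3)
    | Cell Oa b => Some (q, stay x0, stay x1, right x2,
                         right (bool_sym (if x1 is SA then true else false)))
    | Cell Ob b => Some (q, stay x0, stay x1, right x2,
                         right (bool_sym (if x1 is SA then false else true)))
    | Cell o b => Some ((if is_binary o then PBin else PUnary, pol, ok, fr),
                        stay x0, stay x1, stay x2, left x3)
    | _ => Some ((PEnd, pol, ok, fr), stay x0, stay x1, stay x2, left x3)
    end
  | PUnary =>
    match x2, sym_bool x3 with
    | Cell o b, Some v =>
      let b' := unary_bit o fr b in
      Some ((PEval, pol, ok, fr), stay x0, stay x1,
            right (Cell o (unary_new o b' v)), right (bool_sym (unary_val o b' v)))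
    | _, _ => Some ((PEval, pol, ok, fr), stay x0, stay x1, right x2, stay x3)
    end
  | PBin =>
    if sym_bool x3 is Some v then
      Some ((PBin2 v, pol, ok, fr), stay x0, stay x1, stay x2, left Bl)
    else Some ((PEval, pol, ok, fr), stay x0, stay x1, right x2, stay x3)
  | PBin2 v =>
    match x2, sym_bool x3 with
    | Cell o b, Some u =>
      Some ((PEval, pol, ok, fr), stay x0, stay x1, right x2,
            right (bool_sym (binary_val o u v)))
    | _, _ => Some ((PEval, pol, ok, fr), stay x0, stay x1, right x2,
                    right (bool_sym v))
    end
  | PEnd =>
    Some ((PRewind, pol, if sym_bool x3 is Some v then v == pol else false, false),
          stay x0, left x1, left x2, left Bl)
  | PNext =>
    if is_blank x1 then
      Some ((PInc, pol, ok, fr), stay x0, left Bl, stay x2, stay x3)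
    else Some (q, stay x0, right x1, stay x2, stay x3)
  | PInc =>
    if x2 is Cell o b then
      if op_succ o is Some o' then
        Some ((PRewind, pol, true, fr), stay x0, stay x1, stay (Cell o' false), stay x3)
      else Some (q, stay x0, stay x1, right (Cell Onop false), stay x3)
    else Some ((PRej, pol, ok, fr), stay x0, stay x1, stay x2, stay x3)
  | PAcc | PRej => None
  end.

Definition sym_ord (x : sym) : 'I_(16.+4.+2) := inord (sym_code x).
Definition ord_sym (i : 'I_(16.+4.+2)) : sym := nth Bl syms i.
Definition state_ord (q : state) : 'I_(111.+1) := inord (state_code q).
Definition ord_state (i : 'I_(111.+1)) : state := nth state0 states i.

Definition ord_action (a : action) : 'I_(16.+4.+2) * move := (sym_ord a.1, a.2).

Definition tape0 : 'I_(3.+1) := @Ordinal 4 0 isT.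
Definition tape1 : 'I_(3.+1) := @Ordinal 4 1 isT.
Definition tape2 : 'I_(3.+1) := @Ordinal 4 2 isT.
Definition tape3 : 'I_(3.+1) := @Ordinal 4 3 isT.

Definition machine : TM :=
  @Build_TM 111 16 3
    (fun q xs =>
       if delta (ord_state q) (ord_sym (tnth xs tape0)) (ord_sym (tnth xs tape1))
            (ord_sym (tnth xs tape2)) (ord_sym (tnth xs tape3))
         is Some (q', a0, a1, a2, a3)
       then Some (state_ord q',
                  [tuple ord_action a0; ord_action a1; ord_action a2; ord_action a3])
       else None)
    (fun q => if ord_state q is (PAcc, _, _, _) then true else false).

Lemma sym_ordK : cancel sym_ord ord_sym.
Proof. by case=> [||||||[] []]; rewrite /ord_sym /sym_ord inordK. Qed.

Lemma state_ordK : cancel state_ord ord_state.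
Proof.
case=> [[[ph pol] ok] fr]; rewrite /ord_state /state_ord inordK.
  by case: ph => [|||||||[]|||||]; case: pol; case: ok; case: fr.
by case: ph => [|||||||[]|||||]; case: pol; case: ok; case: fr.
Qed.

(** * Tapes as zippers *)

(* [(L, R)] is the tape [rev L ++ R], then blanks, with the head on the first
   cell of [R]. *)
Definition zipper : Type := (seq sym * seq sym)%type.

Definition zread (z : zipper) : sym := head Bl z.2.

(** A blank written at the right end is dropped, so that runs can be stated as equalities of
    zippers. *)
Definition zcons (x : sym) (R : seq sym) : seq sym :=
  if is_blank x && nilp R then [::] else x :: R.

Definition zact (a : action) (z : zipper) : zipper :=
  let: (x, m) := a in
  let: (L, R) := z in
  match m, L with
  | MRight, _ => (x :: L, behead R)
  | MStay, _ | MLeft, [::] => (L, zcons x (behead R))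
  | MLeft, y :: L' => (L', y :: zcons x (behead R))
  end.

Definition zconfig : Type := (state * zipper * zipper * zipper * zipper)%type.

Definition zdelta (a : zconfig) :=
  let: (q, t0, t1, t2, t3) := a in delta q (zread t0) (zread t1) (zread t2) (zread t3).

Definition zstep (a : zconfig) : zconfig :=
  let: (q, t0, t1, t2, t3) := a in
  if zdelta a is Some (q', a0, a1, a2, a3) then
    (q', zact a0 t0, zact a1 t1, zact a2 t2, zact a3 t3)
  else a.

Definition ztape (z : zipper) (t : nat -> 'I_(16.+4.+2)) (h : nat) : Prop :=
  h = size z.1 /\ forall p, t p = sym_ord (nth Bl (catrev z.1 z.2) p).

Lemma ztape_read z t h : ztape z t h -> ord_sym (t h) = zread z.
Proof.
case: z => L R [-> ->]; rewrite sym_ordK catrevE nth_cat size_rev ltnn subnn.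
by case: R.
Qed.

Lemma nth_zcons x R p : nth Bl (zcons x R) p = nth Bl (x :: R) p.
Proof. by rewrite /zcons; case: x => //; case: R => //; case: p => [|[]]. Qed.

Lemma nth_catrev_zcons L x R p :
  nth Bl (catrev L (zcons x R)) p = nth Bl (catrev L (x :: R)) p.
Proof. by rewrite !catrevE !nth_cat nth_zcons. Qed.

Lemma nth_catrev_set L x R p :
  nth Bl (catrev L (x :: behead R)) p =
  if p == size L then x else nth Bl (catrev L R) p.
Proof.
rewrite !catrevE !nth_cat size_rev; case: ltngtP => // [lt|->].
  by case: (p - _) (subn_gt0 (size L) p) R => [|i _ [|? ?]] //=; [rewrite lt | case: i].
by rewrite subnn.
Qed.

Lemma ztape_act a z t h : ztape z t h ->
  ztape (zact a z) (fun p => if p == h then sym_ord a.1 else t p) (movehead a.2 h).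
Proof.
case: a z => [x m] [L R] [/= -> tE]; split.
  by case: m L {tE} => [] [|y L].
move=> p; rewrite tE -fun_if -nth_catrev_set; congr sym_ord.
by case: m => //; first case: L {tE} => [|y L]; rewrite -nth_catrev_zcons.
Qed.

(** * Simulation *)

Definition zsim (c : cfg machine) (a : zconfig) : Prop :=
  let: (q, t0, t1, t2, t3) := a in
  cst c = state_ord q /\
  forall i : 'I_(3.+1),
    ztape (nth ([::], [::]) [:: t0; t1; t2; t3] i) (ctape c i) (chead c i).

Lemma zsim_delta c q t0 t1 t2 t3 : zsim c (q, t0, t1, t2, t3) ->
  tm_delta (cst c) (read c) =
  if delta q (zread t0) (zread t1) (zread t2) (zread t3) is Some (q', a0, a1, a2, a3)
  then Some (state_ord q',
             [tuple ord_action a0; ord_action a1; ord_action a2; ord_action a3])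
  else None.
Proof.
case=> qE tE /=; rewrite qE state_ordK !tnth_mktuple.
by rewrite (ztape_read (tE tape0)) (ztape_read (tE tape1)) (ztape_read (tE tape2))
           (ztape_read (tE tape3)).
Qed.

Lemma zsim_step c a : zsim c a -> zsim (step c) (zstep a).
Proof.
case: a => [[[[q t0] t1] t2] t3] ca; rewrite /step (zsim_delta ca) /zstep /zdelta.
case: delta => [[[[[q' a0] a1] a2] a3]|] //.
case: ca => qE tE; split => //= i.
rewrite (tnth_nth (ord_action a0)) /=.
have := tE i; case: i => [[|[|[|[|]]]]] //= lt_i; exact: ztape_act.
Qed.

Lemma zsim_run c a n : zsim c a -> zsim (iter n (@step machine) c) (iter n zstep a).
Proof. by move=> ca; elim: n => //= n; apply: zsim_step. Qed.

Lemma zsim_halted c a : zsim c a -> zdelta a = None -> halted c.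
Proof.
case: a => [[[[q t0] t1] t2] t3] ca /= dE.
by rewrite /halted (zsim_delta ca) dE.
Qed.

Lemma chead_step (M : TM) (c : cfg M) i : chead (step c) i <= (chead c i).+1.
Proof.
rewrite /step; case: tm_delta => [[q acts]|] //=.
by case: (tnth _ _).2 => //=; lia.
Qed.

Lemma chead_run (M : TM) x n i : chead (@run M x n) i <= n.
Proof.
elim: n => [|n IHn] //=; apply: leq_trans (chead_step _ _) _.
by rewrite ltnS.
Qed.

Definition zinit (xs : seq sym) : zconfig :=
  (state0, ([::], xs), ([::], [::]), ([::], [::]), ([::], [::])).

Lemma zsim_init xs : zsim (init machine [seq sym_code x | x <- xs]) (zinit xs).
Proof.
split; first by apply: val_inj; rewrite /= inordK.
case=> [[|[|[|[|]]]]] //= lt_i; split=> //= p; rewrite ?nth_nil //.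
congr inord.
by elim: xs p => [|x xs IHxs] [|p] //=.
Qed.

(** * Reachability within a number of steps *)

Definition zreach (n : nat) (a b : zconfig) : Prop :=
  exists2 m, m <= n & iter m zstep a = b.

Lemma zreach_refl n a : zreach n a a.
Proof. by exists 0. Qed.

Lemma zreach_step n a b : zreach n (zstep a) b -> zreach n.+1 a b.
Proof. by case=> m le_mn <-; exists m.+1 => //; rewrite iterSr. Qed.

Lemma zreach_trans m n a b c : zreach m a b -> zreach n b c -> zreach (m + n) a c.
Proof.
case=> i le_im <- [j le_jn <-]; exists (j + i); first by lia.
by rewrite iterD.
Qed.

Lemma zreach_le m n a b : m <= n -> zreach m a b -> zreach n a b.
Proof. by move=> le_mn [i le_im ab]; exists i => //; apply: leq_trans le_mn. Qed.

Lemma zreach_decides n xs ph r t0 t1 t2 t3 (P : Prop) T :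
  n < T -> zreach n (zinit xs) (ph, r.1.1, r.1.2, r.2, t0, t1, t2, t3) ->
  (ph = PAcc /\ P) \/ (ph = PRej /\ ~ P) ->
  decides_within machine [seq sym_code x | x <- xs] P T T.
Proof.
move=> lt_nT [m le_mn runE] phP; exists m.
have := zsim_run m (zsim_init xs); rewrite runE -/(run _ _ _) => sim.
split; first by lia.
split; first by apply: zsim_halted sim _; case: phP => [] [-> _].
(* A head position is at most the elapsed time, hence below [T] because [n < T]. *)
split; last by move=> t le_tm i; apply: leq_ltn_trans (chead_run _ _ _) _; lia.
by case: sim => -> _; rewrite [tm_accept _]/= state_ordK; case: phP => [] [-> ?].
Qed.

(** * Truth values along a word *)

Fixpoint tails (x : seq letter) : seq (seq letter) :=
  if x is _ :: x' then x :: tails x' else [::].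

(* [bsat f x] is the truth value of [f] at the first position of the suffix [x];
   on the empty suffix F is false and G is true, the values from which they are
   updated from right to left. *)
Fixpoint bsat (f : ltl) (x : seq letter) : bool :=
  match f with
  | Atom La => if x is La :: _ then true else false
  | Atom Lb => if x is Lb :: _ then true else false
  | And p q => bsat p x && bsat q x
  | Or p q => bsat p x || bsat q x
  | Next p => ~~ nilp (behead x) && bsat p (behead x)
  | Fin p => has (bsat p) (tails x)
  | Glob p => all (bsat p) (tails x)
  end.

Lemma has_tails (P : pred (seq letter)) x :
  has P (tails x) <-> exists2 i, i < size x & P (drop i x).
Proof.
elim: x => [|c x IHx]; first by split=> // [[]].
split=> [/= /orP[Px|/IHx[i lt_i Pi]]|[[|i] //= lt_i Pi]].
- by exists 0.
- by exists i.+1.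
- by rewrite Pi.
by apply/orP; right; apply/IHx; exists i.
Qed.

Lemma all_tails (P : pred (seq letter)) x :
  all P (tails x) <-> forall i, i < size x -> P (drop i x).
Proof.
elim: x => [|c x IHx]; first by [].
split=> [/= /andP[Px /IHx Px'] [|i] //=|Px /=]; first exact: Px'.
by rewrite (Px 0) //; apply/IHx => i; apply: (Px i.+1).
Qed.

(** Positions count from 1, so position [j.+1] starts the suffix [drop j w]; formulas only look to
    the right. *)
Lemma satP w f j : j < size w -> sat w f j.+1 <-> bsat f (drop j w).
Proof.
elim: f j => [c|p IHp q IHq|p IHp q IHq|p IHp|p IHp|p IHp] j lt_j /=.
- rewrite /letter_at /= (drop_nth La lt_j).
  by case: c; case: nth.
- by rewrite IHp // IHq //; split=> [[-> ->]|/andP].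
- by rewrite IHp // IHq //; split=> [?|/orP] //; apply/orP.
- rewrite -drop1 drop_drop add1n /nilp size_drop subn_eq0 -ltnNge.
  split=> [[lt]|/andP[lt]]; first by rewrite lt IHp.
  by rewrite -IHp.
- rewrite has_tails size_drop; split=> [[[|i] [/andP[le_ji lt_i]]]|[i lt_i]].
    by [].
  by rewrite IHp // => ?; exists (i - j); [lia | rewrite drop_drop subnK].
  rewrite drop_drop -IHp; last by lia.
  by exists (i + j).+1; split=> //; lia.
rewrite all_tails size_drop; split=> [satp i lt_i|satp [|i] // /andP[le_ji lt_i]].
  rewrite drop_drop -IHp; [apply: satp|]; lia.
by rewrite IHp // -(subnK (m := j) (n := i)) // -drop_drop; apply: satp; lia.
Qed.

Lemma modelsP w f : 0 < size w -> models w f <-> bsat f w.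
Proof. by move=> w_gt0; rewrite /models satP // drop0. Qed.

(** * Formulas in postfix notation *)

(* An operator that lacks arguments is ignored, so every list of operators
   denotes a stack of formulas. *)
Definition push_op (fs : seq ltl) (o : op) : seq ltl :=
  match o, fs with
  | Oa, _ => Atom La :: fs
  | Ob, _ => Atom Lb :: fs
  | Oand, q :: p :: r => And p q :: r
  | Oor, q :: p :: r => Or p q :: r
  | Onext, p :: r => Next p :: r
  | Ofin, p :: r => Fin p :: r
  | Oglob, p :: r => Glob p :: r
  | _, _ => fs
  end.

Definition formulas (s : seq op) : seq ltl := foldl push_op [::] s.

Fixpoint postfix (f : ltl) : seq op :=
  match f with
  | Atom La => [:: Oa]
  | Atom Lb => [:: Ob]
  | And p q => postfix p ++ postfix q ++ [:: Oand]
  | Or p q => postfix p ++ postfix q ++ [:: Oor]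
  | Next p => postfix p ++ [:: Onext]
  | Fin p => postfix p ++ [:: Ofin]
  | Glob p => postfix p ++ [:: Oglob]
  end.

Lemma size_postfix f : size (postfix f) = fsize f.
Proof.
elim: f => [[]|p IHp q IHq|p IHp q IHq|p IHp|p IHp|p IHp] //=;
  by rewrite !size_cat /= ?IHp ?IHq; lia.
Qed.

Lemma foldl_postfix f fs : foldl push_op fs (postfix f) = f :: fs.
Proof.
elim: f fs => [[]|p IHp q IHq|p IHp q IHq|p IHp|p IHp|p IHp] fs //=;
  by rewrite !foldl_cat ?IHp ?IHq.
Qed.

Lemma push_op_size fs o : size (push_op fs o) <= (size fs).+1.
Proof. by case: o fs => [] [|p [|q fs]] //=; lia. Qed.

Lemma foldl_push_size fs s : size (foldl push_op fs s) <= size fs + size s.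
Proof.
elim: s fs => [|o s IHs] fs /=; first by lia.
by have := IHs (push_op fs o); have := push_op_size fs o; lia.
Qed.

(** An operator creates at most one node and keeps the other formulas as they are, so [k] operators
    yield no formula larger than [k]. *)
Lemma push_op_fsize fs o :
  sumn (map fsize (push_op fs o)) <= (sumn (map fsize fs)).+1.
Proof. by case: o fs => [] [|p [|q fs]] //=; lia. Qed.

Lemma foldl_push_fsize fs s :
  sumn (map fsize (foldl push_op fs s)) <= sumn (map fsize fs) + size s.
Proof.
elim: s fs => [|o s IHs] fs /=; first by lia.
by have := IHs (push_op fs o); have := push_op_fsize fs o; lia.
Qed.

Definition top_is (fs : seq ltl) (p : bool) (x : seq letter) : bool :=
  if fs is f :: _ then bsat f x == p else false.

Definition all_top (fs : seq ltl) (ws : seq (bool * seq letter)) : bool :=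
  all (fun pw => top_is fs pw.1 pw.2) ws.

(** Idle operators pad a postfix word to length [k]; conversely the top of the stack is the formula.
    Since there is some word to test, passing excludes an empty stack. *)
Lemma all_top_separable k (ws : seq (bool * seq letter)) : 0 < size ws ->
  (exists2 s, size s = k & all_top (formulas s) ws) <->
  (exists2 f, fsize f <= k & all (fun pw => bsat f pw.2 == pw.1) ws).
Proof.
case: ws => // pw ws _; split=> [[s sk]|[f fk fws]].
  have := foldl_push_fsize [::] s; rewrite -/(formulas s) sk.
  by case: formulas => [|f fs] //= le_fk fws; exists f => //; lia.
exists (postfix f ++ nseq (k - fsize f) Onop).
  by rewrite size_cat size_postfix size_nseq; lia.
suff ->: formulas (postfix f ++ nseq (k - fsize f) Onop) = [:: f] by [].
by rewrite /formulas foldl_cat foldl_postfix; elim: (_ - _).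
Qed.

(** * Runs of the machine *)

Definition cells (s : seq (op * bool)) : seq sym := [seq Cell ob.1 ob.2 | ob <- s].

Definition ops_of (s : seq (op * bool)) : seq op := [seq ob.1 | ob <- s].

(** Invariant for the bit of [o] once the suffix [x] has been read, where [fs] is the stack that [o]
    acts on. *)
Definition bit_ok (x : seq letter) (fs : seq ltl) (o : op) (b : bool) : Prop :=
  match o, fs with
  | Onext, p :: _ => b = bsat p x
  | Ofin, p :: _ => b = bsat (Fin p) x
  | Oglob, p :: _ => b = bsat (Glob p) x
  | _, _ => True
  end.

Fixpoint bits_ok (x : seq letter) (fs : seq ltl) (s : seq (op * bool)) : Prop :=
  if s is (o, b) :: s' then bit_ok x fs o b /\ bits_ok x (push_op fs o) s' else True.

Definition values (x : seq letter) (fs : seq ltl) : seq sym :=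
  [seq bool_sym (bsat f x) | f <- fs].

Lemma sym_boolK b : sym_bool (bool_sym b) = Some b.
Proof. by case: b. Qed.

Ltac zrun1 := apply: zreach_step; rewrite /zstep /zdelta /zread /= ?sym_boolK /=.

(** One pass turns memory valid for [x] into memory valid for [c :: x]. For empty [x] the register
    [fr] replaces the stored bits by defaults, so they may be arbitrary. The factor 3 is the cost of
    a binary operator: one step to dispatch, two to treat the arguments. *)
Lemma run_eval pol ok c x L0 L1 R1 L s fs : x = [::] \/ bits_ok x fs s ->
  exists s', [/\ ops_of s' = ops_of s, bits_ok (c :: x) fs s' &
    zreach (3 * size s)
      (PEval, pol, ok, nilp x, (L0, [::]), (L1, letter_sym c :: R1),
        (L, cells s), (values (c :: x) fs, [::]))
      (PEval, pol, ok, nilp x, (L0, [::]), (L1, letter_sym c :: R1),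
        (catrev (cells s') L, [::]),
        (values (c :: x) (foldl push_op fs (ops_of s)), [::]))].
Proof.
have zletter R : zcons (letter_sym c) R = letter_sym c :: R by case: c.
elim: s L fs => [|[o b] s IHs] L fs bs.
  by exists [::]; split=> //; apply: zreach_refl.
have bs' : x = [::] \/ bits_ok x (push_op fs o) s.
  by case: bs => [|[]]; [left | right].
have bo : x = [::] \/ bit_ok x fs o b by case: bs => [|[]]; [left | right].
(* The bit written back: operators without memory, or lacking an argument, keep theirs. *)
pose b' := match o, fs with
  | Onext, p :: _ => bsat p (c :: x)
  | Ofin, p :: _ => bsat (Fin p) (c :: x)
  | Oglob, p :: _ => bsat (Glob p) (c :: x)
  | _, _ => b
  end.
have [s' [s'E s'ok reach]] := IHs (Cell o b' :: L) (push_op fs o) bs'.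
exists ((o, b') :: s'); split; first by rewrite /= s'E.
  by split=> //; rewrite /b'; case: (o) (fs) => [] [|p fs'].
rewrite mulnS; apply: zreach_trans reach.
case: (o) fs @b' bo {bs bs' s'E s'ok IHs} => [] [|q [|p fs]] b' bo;
  case: c @b' zletter => b' zletter; zrun1.
all: try exact: zreach_refl.
all: zrun1.
all: try exact: zreach_refl.
all: try by zrun1; apply: zreach_refl.
(* Unary operators with an argument remain: the defaults apply at the last position, elsewhere [bo]
   gives the stored bit. *)
all: case: x bo @b' => [|a x] bo b'; first exact: zreach_refl.
all: case: bo => // bo; move: @b'; rewrite bo => b'; exact: zreach_refl.
Qed.

(* The tape [rev ls ++ R] with the head on the head of [ls]. *)
Definition zat (ls R : seq sym) : zipper :=
  if ls is y :: l then (l, y :: R) else ([::], R).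

(* The stack tape with the head on the top of the stack. *)
Definition ztop (vs : seq sym) : zipper :=
  if vs is v :: vs' then (vs', [:: v]) else ([::], [::]).

(** Rewinding tape 2 also clears the stack: every step erases one value, including the step on the
    left blank, whence the bound [(size l).+1]. The condition on [y] lets tape 1 keep its form when
    [y] is rewritten. *)
Lemma run_rewind pol ok fr L0 L1 y R1 l R vs :
  zcons y R1 = y :: R1 -> size vs <= (size l).+1 ->
  zreach (size l).+1
    (PRewind, pol, ok, fr, (L0, [::]), (L1, y :: R1), zat (cells l ++ [:: Bl]) R, ztop vs)
    (PMain, pol, ok, fr, (L0, [::]), (L1, y :: R1),
      ([:: Bl], catrev (cells l) R), ([::], [::])).
Proof.
move=> zy; elim: l R vs => [|[o b] l IHl] R vs le_vs; apply: zreach_step;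
  rewrite /zstep /zdelta /zread /= ?zy.
  by case: vs le_vs => [|v [|? ?]] // _; apply: zreach_refl.
have {IHl} := IHl (Cell o b :: R) (behead vs); rewrite size_behead.
case: l le_vs => [|[o' b'] l] /= le_vs IHl.
  by case: vs le_vs IHl => [|v [|v' vs]] /= le_vs IHl; apply: IHl; lia.
by case: vs le_vs IHl => [|v [|v' vs]] /= le_vs IHl; apply: IHl; lia.
Qed.

Lemma catrev_cells l L : catrev (cells l) L = cells (rev l) ++ L.
Proof. by rewrite catrevE /cells map_rev. Qed.

(* The state in which a candidate formula is about to be evaluated at the
   position under the head of tape 1. *)
Definition ready (pol ok fr : bool) (L0 : seq sym) (t1 : zipper)
    (s : seq (op * bool)) : zconfig :=
  (PMain, pol, ok, fr, (L0, [::]), t1, ([:: Bl], cells s), ([::], [::])).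

Lemma run_letter pol ok c x L0 y ls R s : x = [::] \/ bits_ok x [::] s ->
  exists s', [/\ ops_of s' = ops_of s, bits_ok (c :: x) [::] s' &
    zreach (4 * size s + 4)
      (ready pol ok (nilp x) L0 (zat (letter_sym c :: y :: ls) R) s)
      (ready pol (top_is (formulas (ops_of s)) pol (c :: x)) false L0
         (zat (y :: ls) (letter_sym c :: R)) s')].
Proof.
move=> bs; have [s' [s'E s'ok ev]] := run_eval pol ok c L0 (y :: ls) R [:: Bl] bs.
exists s'; split=> //.
have zc T : zcons (letter_sym c) T = letter_sym c :: T by case: c {ev s'ok}.
(* One step enters the pass, [3 * size s] perform it, one leaves it, one compares the top value with
   the polarity, and rewinding takes [(size s).+1]. *)
have -> : 4 * size s + 4 = (3 * size s + (size s).+3).+1 by lia.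
apply: zreach_step.
have -> : zstep (ready pol ok (nilp x) L0 (zat (letter_sym c :: y :: ls) R) s) =
    (PEval, pol, ok, nilp x, (L0, [::]), (y :: ls, letter_sym c :: R),
      ([:: Bl], cells s), ([::], [::])).
  by case: c {ev s'ok zc} => /=; case: s {bs s'E} => [|[o b] s].
apply: zreach_trans ev _.
set vs := values _ _.
have vsE : vs = values (c :: x) (formulas (ops_of s)) by [].
have size_vs : size vs <= size s.
  by rewrite size_map -(size_map (@fst op bool)) (foldl_push_size [::]).
have szE : size s' = size s by rewrite -(size_map fst) -/(ops_of _) s'E size_map.
apply: zreach_step.
rewrite catrev_cells.
have -> : zstep (PEval, pol, ok, nilp x, (L0, [::]), (y :: ls, letter_sym c :: R),
      (cells (rev s') ++ [:: Bl], [::]), (vs, [::])) =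
    (PEnd, pol, ok, nilp x, (L0, [::]), (y :: ls, letter_sym c :: R),
      (cells (rev s') ++ [:: Bl], [::]), ztop vs).
  by rewrite /zstep /zdelta /zread /= zc; case: (vs).
apply: zreach_step.
set ok' := top_is _ _ _.
have -> : zstep (PEnd, pol, ok, nilp x, (L0, [::]), (y :: ls, letter_sym c :: R),
      (cells (rev s') ++ [:: Bl], [::]), ztop vs) =
    (PRewind, pol, ok', false, (L0, [::]), (ls, y :: letter_sym c :: R),
      zat (cells (rev s') ++ [:: Bl]) [::], ztop (behead vs)).
  rewrite /zstep /zdelta /zread /= zc.
  have -> : (if sym_bool (head Bl (ztop vs).2) is Some v then v == pol else false) = ok'.
    rewrite vsE /ok'; by case: (formulas _) => [|f fs] //=; rewrite sym_boolK.
  by case: (rev s') => [|[? ?] ?] /=; case: (vs) => [|? [|? ?]].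
have := @run_rewind pol ok' false L0 ls y (letter_sym c :: R) (rev s') [::] (behead vs).
rewrite size_rev szE catrev_cells revK cats0; apply.
  by case: (y).
by rewrite size_behead; lia.
Qed.

(** [r] lists the letters still to be read, from right to left, and [x] is the suffix already read,
    so [catrev r x] is the whole word. Each letter overwrites the verdict [ok]; the one that
    survives belongs to position 1. *)
Lemma run_word pol ok x L0 r y ls R s : x = [::] \/ bits_ok x [::] s ->
  exists s', ops_of s' = ops_of s /\
    zreach ((4 * size s + 4) * size r)
      (ready pol ok (nilp x) L0 (zat (map letter_sym r ++ y :: ls) R) s)
      (ready pol (if r is [::] then ok else top_is (formulas (ops_of s)) pol (catrev r x))
         (nilp (catrev r x)) L0 (zat (y :: ls) (catrev (map letter_sym r) R)) s').
Proof.
elim: r x ok R s => [|c r IHr] x ok R s bs.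
  by exists s; split=> //; apply: zreach_refl.
case E : (map letter_sym r ++ y :: ls) => [|z zs]; first by case: (r) E.
have [s1 [s1E s1ok run1]] := run_letter pol ok c L0 z zs R bs.
have [s' [s'E run']] := IHr (c :: x) (top_is (formulas (ops_of s)) pol (c :: x)) 
  (letter_sym c :: R) s1 (or_intror s1ok).
have sz : size s1 = size s by rewrite -(size_map fst) -/(ops_of _) s1E size_map.
exists s'; split; first by rewrite s'E.
rewrite [size (c :: r)]/= mulnS /= E; apply: zreach_trans run1 _.
by move: run'; rewrite E s1E sz; case: (r).
Qed.

(* Tape 1 read from right to left: each word, reversed, follows its marker. *)
Definition backward (ws : seq (bool * seq letter)) : seq sym :=
  flatten [seq mark_sym pw.1 :: map letter_sym (rev pw.2) | pw <- ws] ++ [:: Bl].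

Lemma backward_cons p w ws :
  backward ((p, w) :: ws) = mark_sym p :: map letter_sym (rev w) ++ backward ws.
Proof. by rewrite /backward /= -catA. Qed.

Lemma backward_head ws : exists y l, backward ws = y :: l.
Proof.
by case: ws => [|[p w] ws]; [exists Bl, [::] | rewrite backward_cons; do 2!eexists].
Qed.

Definition phase_of (a : zconfig) : phase :=
  let: (ph, _, _, _, _, _, _, _) := a in ph.

Definition nonblank (l : seq sym) : bool := all (fun x => ~~ is_blank x) l.

Lemma nonblank_letters w : nonblank (map letter_sym w).
Proof. by elim: w => [|[] w]. Qed.

Definition next_candidate pol ok fr L0 t1 (s : seq (op * bool)) : zconfig :=
  (PNext, pol, ok, fr, (L0, [::]), t1, ([:: Bl], cells s), ([::], [::])).

(** A marker stands at the right end of its word, so the verdict on a word is examined at the next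
    marker to the left or at the left blank; [ok] is the verdict still pending. On failure the
    contents of tape 1 are intact, and the cells from the head on are nonblank, which lets [PNext]
    find the right end. *)
Lemma run_words ws pol ok fr L0 R s :
  all (fun pw => 0 < size pw.2) ws -> nonblank R ->
  exists pol' ok' fr' s', ops_of s' = ops_of s /\
    if ok && all_top (formulas (ops_of s)) ws then
      exists2 a, zreach ((4 * size s + 4) * size (backward ws))
        (ready pol ok fr L0 (zat (backward ws) R) s) a & phase_of a = PAcc
    else exists l R', [/\ nonblank R', catrev l R' = catrev (backward ws) R &
      zreach ((4 * size s + 4) * size (backward ws))
        (ready pol ok fr L0 (zat (backward ws) R) s)
        (next_candidate pol' ok' fr' L0 (l, R') s')].
Proof.
elim: ws pol ok fr R s => [|[p w] ws IHws] pol ok fr R s.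
  move=> _ Rnb; exists pol, ok, fr, s; split=> //; rewrite andbT.
  case: ok; last exists [:: Bl], R.
    exists (zstep (ready pol true fr L0 (zat (backward [::]) R) s)).
      by rewrite muln1 addn4; apply: zreach_step; apply: zreach_refl.
    by case: s => [|[]].
  split=> //; rewrite muln1 addn4; apply: zreach_step.
  by rewrite /zstep /zdelta /zread /=; case: s => [|[? ?] ?]; apply: zreach_refl.
case/andP=> w_gt0 ws_gt0 Rnb; rewrite [size _]/= in w_gt0; rewrite backward_cons.
case: ok; last first.
  exists pol, false, fr, s; split=> //.
  exists (map letter_sym (rev w) ++ backward ws), (mark_sym p :: R).
  split; [by case: (p) | by [] |].
  rewrite mulnS addn4 addSn; apply: zreach_step.
  rewrite /zstep /zdelta /zread /=.
  by case: (p); case: s => [|[? ?] ?]; apply: zreach_refl.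
have [y [l bE]] := backward_head ws.
have [s1 [s1E run1]] := @run_word p false [::] L0 (rev w) y l (mark_sym p :: R) s
  (or_introl erefl).
have Rnb' : nonblank (catrev (map letter_sym (rev w)) (mark_sym p :: R)).
  by rewrite catrevE /nonblank all_cat all_rev -/(nonblank _) nonblank_letters; case: (p).
(* The word is nonempty, so the verdict [false] preset at its marker has been overwritten. *)
have okE : (if rev w is [::] then false else
    top_is (formulas (ops_of s)) p (catrev (rev w) [::])) =
    top_is (formulas (ops_of s)) p w.
  rewrite -/(rev (rev w)) revK.
  by case: (rev w) (size_rev w) => // w0; rewrite -w0 in w_gt0.
rewrite {}okE -/(rev (rev w)) revK in run1.
have [pol' [ok' [fr' [s' [s'E IH]]]]] := IHws p (top_is (formulas (ops_of s)) p w)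
  (nilp w) (catrev (map letter_sym (rev w)) (mark_sym p :: R)) s1 ws_gt0 Rnb'.
have sz : size s1 = size s by rewrite -(size_map fst) -/(ops_of _) s1E size_map.
have to_marker : zreach ((4 * size s + 4) * (size w).+1)
    (ready pol true fr L0 (zat (mark_sym p :: map letter_sym (rev w) ++ backward ws) R) s)
    (ready p (top_is (formulas (ops_of s)) p w) (nilp w) L0 (zat (backward ws)
      (catrev (map letter_sym (rev w)) (mark_sym p :: R))) s1).
  rewrite mulnS {1}addn4 addSn; apply: zreach_step; rewrite bE.
  apply: zreach_le (leq_addl _ _) _; rewrite size_rev in run1.
  suff -> : zstep (ready pol true fr L0
      (zat (mark_sym p :: map letter_sym (rev w) ++ y :: l) R) s) =
    ready p false true L0 (zat (map letter_sym (rev w) ++ y :: l) (mark_sym p :: R)) s.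
    exact: run1.
  rewrite /zstep /zdelta /zread /=.
  by case: (map _ _) => [|? ?]; case: (p); case: (s) => [|[]].
exists pol', ok', fr', s'; split; first by rewrite s'E.
have -> : size (mark_sym p :: map letter_sym (rev w) ++ backward ws) =
    (size w).+1 + size (backward ws) by rewrite /= size_cat size_map size_rev.
rewrite s1E sz in IH; rewrite mulnDr.
rewrite [true && _]/=.
case: ifP IH => _ [].
  by move=> a IH aA; exists a => //; apply: zreach_trans to_marker IH.
move=> l' [R' [R'nb R'E IH]]; exists l', R'; split=> //.
  by rewrite R'E [RHS]/= !catrevE rev_cat catA.
exact: zreach_trans to_marker IH.
Qed.

Lemma run_next pol ok fr L0 l R s : nonblank R ->
  zreach (size R).+1 (next_candidate pol ok fr L0 (l, R) s)
    (PInc, pol, ok, fr, (L0, [::]), zat (catrev R l) [::], ([:: Bl], cells s), ([::], [::])).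
Proof.
elim: R l => [|x R IHR] l Rnb; apply: zreach_step.
  by case: l => [|y l]; case: s => [|[o b] s]; apply: zreach_refl.
have /andP[xnb Rnb'] := Rnb.
have := IHR (x :: l) Rnb'; congr zreach.
by case: x xnb {Rnb Rnb' IHR}; case: (s) => [|[o b] s'].
Qed.

(** * Enumeration of the candidates in base 8 *)

Fixpoint next_ops (s : seq op) : option (seq op) :=
  if s is o :: s' then
    if op_succ o is Some o' then Some (o' :: s') else omap (cons Onop) (next_ops s')
  else None.

(** The least significant digit comes first, so a carry moves right; [l] holds the cells left of the
    head in reverse. A carry off the end means that the candidates are exhausted. The bits of [s']
    are left open: stale bits are ignored at the last position of each word. *)
Lemma run_inc pol ok fr L0 L1 y R1 l s : zcons y R1 = y :: R1 ->
  let start := (PInc, pol, ok, fr, (L0, [::]), (L1, y :: R1),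
                (cells l ++ [:: Bl], cells s), ([::], [::])) in
  if next_ops (ops_of s) is Some os then
    exists2 s', ops_of s' = os &
      zreach (2 * size s + size l + 3) start
        (ready pol true fr L0 (L1, y :: R1) (catrev l s'))
  else exists2 a, zreach (2 * size s + size l + 3) start a & phase_of a = PRej.
Proof.
move=> zy; elim: s l => [|[o b] s IHs] l /=.
  eexists; first by rewrite addn3; apply: zreach_step; apply: zreach_refl.
  by [].
case oE : (op_succ o) => [o'|].
  exists ((o', false) :: s) => //.
  apply: (@zreach_le (size l).+3); first by lia.
  apply: zreach_step; rewrite /zstep /zdelta /zread /= oE /= zy.
  have := @run_rewind pol true fr L0 L1 y R1 ((o', false) :: l) (cells s) [::] zy isT.
  have -> : catrev (cells ((o', false) :: l)) (cells s) = cells (catrev l ((o', false) :: s)).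
    by rewrite /cells /= !catrevE map_cat map_rev.
  exact.
have := IHs ((Onop, false) :: l); case: next_ops => [os|] /=.
  case=> s' s'E run; exists ((Onop, false) :: s'); first by rewrite /= s'E.
  apply: (@zreach_le (2 * size s + (size l).+1 + 3).+1); first by lia.
  by apply: zreach_step; rewrite /zstep /zdelta /zread /= oE /= zy.
case=> a run aR; exists a => //.
apply: (@zreach_le (2 * size s + (size l).+1 + 3).+1); first by lia.
by apply: zreach_step; rewrite /zstep /zdelta /zread /= oE /= zy.
Qed.

Fixpoint ops_val (s : seq op) : nat :=
  if s is o :: s' then op_code o + 8 * ops_val s' else 0.

Lemma op_code_lt o : op_code o < 8.
Proof. by case: o. Qed.

Lemma op_code_inj : injective op_code.
Proof. by do 2!case. Qed.

Lemma ops_val_inj s t : size s = size t -> ops_val s = ops_val t -> s = t.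
Proof.
elim: s t => [|o s IHs] [|o' t] //= [sz] E.
have lt_o := op_code_lt o; have lt_o' := op_code_lt o'.
have oE : op_code o = op_code o' by lia.
by rewrite (op_code_inj oE) (IHs t) //; lia.
Qed.

Lemma ops_val_lt s : ops_val s < 8 ^ size s.
Proof.
elim: s => //= o s IHs; rewrite expnS; have := op_code_lt o; lia.
Qed.

Lemma next_opsP s :
  if next_ops s is Some t then size t = size s /\ ops_val t = (ops_val s).+1
  else (ops_val s).+1 = 8 ^ size s.
Proof.
elim: s => //= o s; case: next_ops => [t [sz vE]|vE].
  by case: o => /=; rewrite ?sz ?vE; split=> //; lia.
by case: o => /=; rewrite ?expnS; try (split=> //); lia.
Qed.

Definition accepts (ws : seq (bool * seq letter)) (s : seq op) : bool :=
  all_top (formulas s) ws.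

(** [(4 * k + 4) * N] for evaluating on all words, at most [N + 1] for returning to the right end,
    [2 * k + 3] for the increment, and 2 to spare. *)
Definition candidate_cost (k N : nat) : nat := (4 * k + 5) * N + 2 * k + 6.

Lemma run_candidate pol fr L0 ws s : 0 < size ws ->
  all (fun pw => 0 < size pw.2) ws ->
  let start := ready pol true fr L0 (zat (backward ws) [::]) s in
  let cost := candidate_cost (size s) (size (backward ws)) in
  if accepts ws (ops_of s) then exists2 a, zreach cost start a & phase_of a = PAcc
  else if next_ops (ops_of s) is Some os then
    exists pol' fr' s', ops_of s' = os /\
      zreach cost start (ready pol' true fr' L0 (zat (backward ws) [::]) s')
  else exists2 a, zreach cost start a & phase_of a = PRej.
Proof.
move=> ws_gt0 w_gt0 start cost.
have [pol' [ok' [fr' [s1 [s1E]]]]] := @run_words ws pol true fr L0 [::] s w_gt0 isT.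
have sz : size s1 = size s by rewrite -(size_map fst) -/(ops_of _) s1E size_map.
rewrite [true && _]/= -/(accepts _ _); case: ifP => _.
  by case=> a run aA; exists a => //; apply: zreach_le run;
    rewrite /cost /candidate_cost; lia.
case=> l [R [Rnb RE run]].
(* Tape 1 is unchanged, so the next candidate starts from the same zipper. *)
have bE : catrev R l = backward ws.
  have RE' : rev l ++ R = rev (backward ws) by rewrite -catrevE.
  by rewrite catrevE -(revK l) -rev_cat RE' revK.
have le_R : size R <= size (backward ws).
  by have := congr1 size bE; rewrite catrevE size_cat size_rev; lia.
have {}run := zreach_trans run (run_next pol' ok' fr' L0 l s1 Rnb).
have [y [ls zE]] : exists y ls,
    zat (backward ws) [::] = (ls, [:: y]) /\ zcons y [::] = [:: y].
  case: ws ws_gt0 {w_gt0 start cost run bE le_R RE} => // [[p w] ws] _; rewrite backward_cons.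
  by exists (mark_sym p); eexists; split; last case: (p).
case: zE => zE zy; rewrite bE zE in run; rewrite {}/start zE.
have := @run_inc pol' ok' fr' L0 ls y [::] [::] s1 zy.
rewrite s1E sz; case: next_ops => [os|].
  case=> s' s'E inc; exists pol', fr', s'; split=> //.
  apply: zreach_le (zreach_trans run inc).
  by rewrite /cost /candidate_cost /=; lia.
case=> a inc aR; exists a => //; apply: zreach_le (zreach_trans run inc).
by rewrite /cost /candidate_cost /=; lia.
Qed.

(** [j] bounds the number of candidates left, including the current one. Once that one is rejected
    only larger values remain, as a value determines its candidate. *)
Lemma run_candidates pol fr L0 ws s j : 0 < size ws ->
  all (fun pw => 0 < size pw.2) ws -> 8 ^ size s <= ops_val (ops_of s) + j ->
  exists2 a, zreach (j * candidate_cost (size s) (size (backward ws)))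
      (ready pol true fr L0 (zat (backward ws) [::]) s) a &
    let found := exists t,
      [/\ size t = size s, ops_val (ops_of s) <= ops_val t & accepts ws t] in
    (phase_of a = PAcc /\ found) \/ (phase_of a = PRej /\ ~ found).
Proof.
move=> ws_gt0 w_gt0; elim: j pol fr s => [|j IHj] pol fr s le_j.
  (* For [j = 0] the value would reach [8 ^ size s], which is impossible at this length. *)
  by have := ops_val_lt (ops_of s); rewrite size_map; lia.
have := run_candidate pol fr L0 s ws_gt0 w_gt0; cbv zeta.
rewrite mulSn; set cost := candidate_cost _ _.
have : size (ops_of s) = size s by rewrite size_map.
case: ifP => [acc szE [a run aA]|rej szE].
  exists a; first by apply: zreach_le run; lia.
  by left; split=> //; exists (ops_of s).
have := next_opsP (ops_of s); case: next_ops => [os [os_sz os_val]|val_max].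
  case=> pol' [fr' [s' [s'E run]]].
  have s'_sz : size s' = size s by rewrite -(size_map fst) -/(ops_of _) s'E os_sz.
  have [|a run' aP] := IHj pol' fr' s'; first by rewrite s'_sz s'E os_val; lia.
  exists a; first by rewrite s'_sz in run'; apply: zreach_trans run run'.
  move: aP => /=; rewrite s'_sz s'E os_val.
  case=> [] [aE found]; [left|right]; split=> //.
    by case: found => t [t_sz le_t acc]; exists t; split=> //; lia.
  (* A candidate of equal value would be the rejected one. *)
  case=> t [t_sz]; rewrite leq_eqVlt => /orP[/eqP tE|lt_t] acc.
    by rewrite (@ops_val_inj (ops_of s) t) ?acc ?t_sz in rej.
  by case: found; exists t.
case=> a run aR; exists a; first by apply: zreach_le run; lia.
right; split=> // [] [t [t_sz le_t acc]].
(* At overflow the value is maximal, so [t] is again the rejected candidate. *)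
have := ops_val_lt t; rewrite t_sz -szE -val_max ltnS => ge_t.
rewrite (@ops_val_inj (ops_of s) t) ?acc ?t_sz // in rej.
by apply/eqP; rewrite eqn_leq le_t.
Qed.

(** * Copying the input *)

Definition copied (x : sym) : bool :=
  match x with Bl | D5 => false | _ => true end.

Lemma run_copy_words q xs ys L0 L1 L2 : all copied xs ->
  zreach (size xs)
    (PCopy, q.1.1, q.1.2, q.2, (L0, xs ++ ys), (L1, [::]), (L2, [::]), ([::], [::]))
    (PCopy, q.1.1, q.1.2, q.2, (catrev xs L0, ys), (catrev xs L1, [::]), (L2, [::]),
      ([::], [::])).
Proof.
elim: xs L0 L1 => [|x xs IHxs] L0 L1 xsP; first exact: zreach_refl.
have /andP[xP xsP'] := xsP.
have := IHxs (x :: L0) (x :: L1) xsP'.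
move=> run; apply: zreach_step; congr zreach: run.
by case: x xP {xsP}.
Qed.

Lemma run_copy_counter q k L0 L1 L2 :
  zreach k (PCopy, q.1.1, q.1.2, q.2, (L0, nseq k D5), (L1, [::]), (L2, [::]), ([::], [::]))
    (PCopy, q.1.1, q.1.2, q.2, (catrev (nseq k D5) L0, [::]), (L1, [::]),
      (catrev (cells (nseq k (Onop, false))) L2, [::]), ([::], [::])).
Proof.
elim: k L0 L2 => [|k IHk] L0 L2; first exact: zreach_refl.
by apply: zreach_step; apply: IHk.
Qed.

(** [rcons xs x] expresses that something is copied. Every unary digit becomes an idle operator, so
    the first candidate is 0 written with [k] digits. *)
Lemma run_init xs x k : all copied (rcons xs x) ->
  exists L0, zreach (size xs + 2 * k + 4) (zinit (rcons xs x ++ nseq k D5))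
    (ready false true false L0 (zat (rev (rcons xs x) ++ [:: Bl]) [::])
      (nseq k (Onop, false))).
Proof.
move=> xsP; exists (catrev (nseq k D5) (rev (rcons xs x))).
(* [(size xs).+2] steps start and copy the words, [k] read the counter, [k.+2] turn and rewind. *)
apply: (@zreach_le ((size xs).+2 + (k + k.+2))); first by lia.
apply: zreach_trans (_ : zreach _ _ (PCopy, false, false, false,
  (rev (rcons xs x), nseq k D5), (rev (rcons xs x) ++ [:: Bl], [::]), ([:: Bl], [::]),
  ([::], [::]))) _.
  apply: zreach_step.
  have -> : zstep (zinit (rcons xs x ++ nseq k D5)) = 
     (PCopy, false, false, false, ([::], rcons xs x ++ nseq k D5), ([:: Bl], [::]),
       ([:: Bl], [::]), ([::], [::])).
    by case: xs xsP => [|[||||||o b] xs] //=; case: x => [||||||o' b'].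
  rewrite -(size_rcons xs x) -catrevE.
  exact: (@run_copy_words (false, false, false)).
apply: zreach_trans (@run_copy_counter (false, false, false) k _ _ _) _.
apply: zreach_step.
rewrite catrev_cells rev_rcons.
have xnb : zcons x [::] = [:: x] by move: xsP; rewrite all_rcons => /andP[]; case: (x).
have := @run_rewind false true false (catrev (nseq k D5) (x :: rev xs)) (rev xs ++ [:: Bl]) x
  [::] (rev (nseq k (Onop, false))) [::] [::] xnb isT.
rewrite size_rev size_nseq catrev_cells revK cats0; congr zreach.
rewrite /zstep /zdelta /zread /=.
by case: (rev (nseq k _)) => [|[? ?] ?].
Qed.

(** * Encoding of the instance, time bound and conclusion *)

Definition labelled (us vs : seq (seq letter)) : seq (bool * seq letter) :=
  [seq (true, u) | u <- us] ++ [seq (false, v) | v <- vs].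

Definition word_syms (ws : seq (bool * seq letter)) : seq sym :=
  flatten [seq rcons (map letter_sym pw.2) (mark_sym pw.1) | pw <- ws].

Lemma encodeE us vs k :
  encode us vs k = map sym_code (word_syms (labelled us vs) ++ nseq k D5).
Proof.
have letE w : map sym_code (map letter_sym w) = map letter_code w.
  by rewrite -map_comp; apply: eq_map; case.
rewrite /encode /word_syms map_cat map_nseq map_flatten /labelled !map_cat flatten_cat.
rewrite -catA -!map_comp; congr (flatten _ ++ (flatten _ ++ _)).
  by apply: eq_map => u /=; rewrite map_rcons letE cats1.
by apply: eq_map => v /=; rewrite map_rcons letE cats1.
Qed.

Lemma backward_rev ws : backward (rev ws) = rev (word_syms ws) ++ [:: Bl].
Proof.
rewrite /backward /word_syms; congr (_ ++ _).
elim: ws => // [[p w] ws IHws]; rewrite rev_cons map_rcons flatten_rcons IHws /=.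
by rewrite rev_cat rev_rcons map_rev.
Qed.

Lemma all_copied ws : all copied (word_syms ws).
Proof.
elim: ws => // [[p w] ws IHws]; rewrite /word_syms /= all_cat -/(word_syms ws) IHws.
by rewrite all_rcons; case: p => /=; elim: w => // [[] w].
Qed.

Lemma size_word_syms ws l : all (fun pw => size pw.2 <= l) ws ->
  size (word_syms ws) <= size ws * l.+1.
Proof.
elim: ws => // [[p w] ws IHws] /= /andP[le_wl /IHws]; rewrite /word_syms /=.
by rewrite size_cat size_rcons size_map mulSn; lia.
Qed.

Lemma separates_all f us vs :
  (forall j, j < size us -> 0 < size (nth [::] us j)) ->
  (forall j, j < size vs -> 0 < size (nth [::] vs j)) ->
  separates f us vs <-> all (fun pw => bsat f pw.2 == pw.1) (labelled us vs).
Proof.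
move=> us_gt0 vs_gt0; rewrite all_cat !all_map; split.
  case=> usP vsP; apply/andP; split; apply/(all_nthP [::]) => j lt_j /=.
    by apply/eqP/modelsP; [apply: us_gt0 | apply: usP].
  apply/eqP/negP => sat_f; apply: (vsP j lt_j); apply/modelsP => //; exact: vs_gt0.
case/andP=> /(all_nthP [::]) usP /(all_nthP [::]) vsP; split=> j lt_j.
  by apply/modelsP; [apply: us_gt0 | apply/eqP/usP].
by move/modelsP => /(_ (vs_gt0 j lt_j)); rewrite (eqP (vsP j lt_j)).
Qed.

(** Here [m.+1] counts the letters and markers, and one more cell is the left blank. With
    [K = 2 ^ k] and [A = n * l] there are [K ^ 3] candidates of cost O(K A) each, so the total is
    O(K ^ 4 A); 60 is a generous choice for both constants. *)
Lemma time_bound k n l m : 0 < n -> 0 < l -> m.+1 <= 2 * n * l.+1 ->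
  m + 2 * k + 4 + 8 ^ k * candidate_cost k m.+2 < 60 * 2 ^ (60 * k) * n * l.
Proof.
move=> n_gt0 l_gt0 le_m; have A_gt0 : 0 < n * l by rewrite muln_gt0 n_gt0.
have {}le_m : m.+1 <= 4 * (n * l) by nia.
have -> : 8 ^ k = (2 ^ k) ^ 3 by rewrite -expnM mulnC expnM.
rewrite -2!mulnA [60 * k]mulnC expnM.
have k_lt : k < 2 ^ k by apply: ltn_expl.
move: (n * l) (2 ^ k) A_gt0 k_lt le_m => A K A_gt0 k_lt le_m.
have K_gt0 : 0 < K by lia.
(* 25 comes from the product below, 6 from [2 * k + 6 <= 6 * (K * A)]. *)
have cost_le : candidate_cost k m.+2 <= 31 * (K * A).
  rewrite /candidate_cost.
  have : (4 * k + 5) * m.+2 <= (5 * K) * (5 * A) by apply: leq_mul; lia.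
  have : K <= K * A by rewrite leq_pmulr.
  nia.
have cost_le4 : K ^ 3 * candidate_cost k m.+2 <= 31 * (K ^ 4 * A).
  apply: leq_trans (_ : K ^ 3 * (31 * (K * A)) <= _).
    by rewrite leq_mul2l cost_le orbT.
  by rewrite mulnCA [K ^ 3 * _]mulnA -expnSr.
have K_le : K <= K ^ 4 by rewrite -{1}[K]expn1 leq_pexp2l.
have K4_le : K ^ 4 <= K ^ 60 by rewrite leq_pexp2l.
have le_KA : K ^ 4 * A <= K ^ 60 * A by rewrite leq_mul2r K4_le orbT.
have : K ^ 4 <= K ^ 4 * A by rewrite leq_pmulr.
have : A <= K ^ 4 * A by rewrite leq_pmull // expn_gt0 K_gt0.
move: (K ^ 4 * A) (K ^ 60 * A) (K ^ 4) cost_le4 le_KA K_le => B C D.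
lia.
Qed.

Theorem theorem1 :
  exists (M : TM) (c : nat),
    forall (n l k : nat) (us vs : seq (seq letter)),
      0 < n -> size us = n -> size vs = n ->
      (forall j, j < n -> 0 < size (nth [::] us j) <= l) ->
      (forall j, j < n -> 0 < size (nth [::] vs j) <= l) ->
      decides_within M (encode us vs k) (separable_within k us vs)
        (c * 2 ^ (c * k) * n * l) (c * 2 ^ (c * k) * n * l).
Proof.
exists machine, 60 => n l k us vs n_gt0 us_n vs_n usP vsP.
set tws := labelled us vs.
have tws_l : all (fun pw => 0 < size pw.2 <= l) tws.
  rewrite all_cat !all_map; apply/andP; split; apply/(all_nthP [::]) => j;
    rewrite ?us_n ?vs_n.
    exact: usP.
  exact: vsP.
have [tws_gt0 tws_le] :
    all (fun pw => 0 < size pw.2) tws /\ all (fun pw => size pw.2 <= l) tws.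
  by apply/andP; rewrite -all_predI.
have l_gt0 : 0 < l by have /andP[] := usP 0 n_gt0; lia.
have sz_tws : size tws = 2 * n by rewrite size_cat !size_map; lia.
have := size_word_syms tws_le; have := all_copied tws.
have := backward_rev tws; rewrite encodeE -/tws sz_tws.
(* Each of the [2 * n] words contributes a marker, so the copied part of the input has a last
   symbol. *)
have : word_syms tws <> [::].
  by case: (tws) sz_tws => [|[p w] ws] /=; [lia | rewrite /word_syms /=; case: w].
case: (lastP (word_syms tws)) => // xs x _ bE xsP le_xs.
rewrite size_rcons in le_xs.
have [L0 init] := run_init k xsP.
(* Tape 1 is read from its right end, so the words come in reverse order. *)
have [|||a run aP] := @run_candidates false false L0 (rev tws) (nseq k (Onop, false)) (8 ^ k).
- by rewrite size_rev sz_tws; lia.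
- by rewrite all_rev.
- by rewrite size_nseq; lia.
rewrite size_nseq bE in run.
have {}run := zreach_trans init run.
have {}le_xs := time_bound k n_gt0 l_gt0 le_xs.
case: a run aP => [[[[[[[ph pol] ok] fr] t0] t1] t2] t3] run aP.
apply: (@zreach_decides _ _ ph (pol, ok, fr) t0 t1 t2 t3 _ _ _ run).
  by rewrite size_cat size_rev size_rcons /= addn1.
suff foundE : separable_within k us vs <-> exists t, [/\ size t = size (nseq k (Onop, false)),
   ops_val (ops_of (nseq k (Onop, false))) <= ops_val t & accepts (rev tws) t].
  by case: aP => [] [/= -> found]; [left|right]; rewrite foundE.
(* Counting starts from 0, so the search ranges over all words of [k] operators. *)
have -> : ops_val (ops_of (nseq k (Onop, false))) = 0.
  by elim: (k) => //= ? ->.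
have sepP f : separates f us vs <-> all (fun pw => bsat f pw.2 == pw.1) tws.
  apply: separates_all => j; rewrite ?us_n ?vs_n => /[dup] lt_j.
    by case/usP/andP.
  by case/vsP/andP.
have tws0 : 0 < size (rev tws) by rewrite size_rev sz_tws; lia.
rewrite size_nseq; apply: iff_trans (_ : _ <-> exists2 t, size t = k & accepts (rev tws) t) _.
  rewrite (all_top_separable k tws0).
  split=> [] [f]; first by case=> f_le /sepP sep; exists f; rewrite // all_rev.
  by move=> f_le; rewrite all_rev => /sepP; exists f.
by split=> [] [t]; [exists t | case=> *; exists t].
Qed.
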